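(* Let $\alpha>0$. The adjusted moments $\widetilde\mu_{i,j}=\int_0^\infty (x-r)^i(x-s)^j\,\widehat W(x)\,dx$ of the Type I $X_2$ exceptional Laguerre weight satisfy: (a) the three-term recursion-like formula $$\widetilde\mu_{i+1,j}=\widetilde\mu_{i,j+1}+2\sqrt{\alpha+1}\,\widetilde\mu_{i,j}\qquad (i,j\in\mathbb N_0);$$ (b) the four-term recursion-like formula $$\begin{aligned}\widetilde\mu_{i+1,j+1}={}&\left[i+j-1+2\alpha+\sqrt{\alpha+1}\right]\widetilde\mu_{i+1,j}\\&+\left[(1-i-j)(\alpha+1)+(3-3i-j-4\alpha)\sqrt{\alpha+1}\right]\widetilde\mu_{i,j}\\&+\left[(2i-4)(\alpha+1)\left(\sqrt{\alpha+1}+1\right)\right]\widetilde\mu_{i-1,j}\qquad (i\in\mathbb N,\ j\in\mathbb N_0).\end{aligned}$$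
   Context: $\mathbb N=\{1,2,\ldots\}$, $\mathbb N_0=\mathbb N\cup\{0\}$. $r=-(\alpha+1)-\sqrt{\alpha+1}$ and $s=-(\alpha+1)+\sqrt{\alpha+1}$ are the two roots of $L_2^{\alpha-1}(-x)=\tfrac12x^2+(\alpha+1)x+\tfrac{\alpha(\alpha+1)}2=\tfrac12(x-r)(x-s)$, where $L_2^{\alpha-1}$ is the classical Laguerre polynomial of degree 2 with parameter $\alpha-1$. The Type I $X_2$ exceptional Laguerre weight is $$\widehat W(x)=\frac{x^{\alpha}e^{-x}}{\left(L_2^{\alpha-1}(-x)\right)^2}\qquad(0<x<\infty).$$ *)

(* Defs.v *)
From HB Require Import structures.
From mathcomp Require Import all_boot all_order all_algebra.
From mathcomp Require Import ring.
From mathcomp Require Import all_classical all_reals all_analysis.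

Set Implicit Arguments.
Unset Strict Implicit.
Unset Printing Implicit Defensive.

Import Order.TTheory GRing.Theory Num.Theory.
Local Open Scope ring_scope.

(* The falling factorial quotient z (z - 1) ... (z - m + 1) / m!, i.e. the
   binomial coefficient with a real upper argument. *)
Definition gbinom (R : realType) (z : R) (m : nat) : R :=
  (\prod_(l < m) (z - l%:R)) / m`!%:R.

(* L_n^a = sum_k (-1)^k binom(n + a, n - k) x^k / k!, the normalization with
   leading coefficient (-1)^n / n!. *)
Definition laguerre (R : realType) (n : nat) (a : R) : {poly R} :=
  \poly_(k < n.+1) ((-1) ^+ k * gbinom (n%:R + a) (n - k) / k`!%:R).

Definition root_r (R : realType) (alpha : R) : R :=
  - (alpha + 1) - Num.sqrt (alpha + 1).

Definition root_s (R : realType) (alpha : R) : R :=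
  - (alpha + 1) + Num.sqrt (alpha + 1).

Definition X2_weight (R : realType) (alpha x : R) : R :=
  x `^ alpha * expR (- x) / (laguerre 2 (alpha - 1)).[- x] ^+ 2.

Definition moment_integrand (R : realType) (alpha : R) (i j : nat) (x : R) : R :=
  (x - root_r alpha) ^+ i * (x - root_s alpha) ^+ j * X2_weight alpha x.

Definition adjusted_moment (R : realType) (alpha : R) (i j : nat) : R :=
  \int[@lebesgue_measure R]_(x in `]0, +oo[%classic) moment_integrand alpha i j x.

Lemma laguerre2E (R : realType) (alpha x : R) :
  (laguerre 2 (alpha - 1)).[- x] =
  x ^+ 2 / 2 + (alpha + 1) * x + alpha * (alpha + 1) / 2.
Proof.
rewrite /laguerre horner_poly !big_ord_recl big_ord0 /= /bump /= /gbinom.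
rewrite !big_ord_recl !big_ord0 /= /bump /= !factS fact0.
by field.
Qed.

Lemma laguerre2_roots (R : realType) (alpha x : R) : 0 < alpha ->
  (laguerre 2 (alpha - 1)).[- x] =
  (x - root_r alpha) * (x - root_s alpha) / 2.
Proof.
move=> a0; rewrite laguerre2E /root_r /root_s.
have /sqr_sqrtr h : 0 <= alpha + 1 by rewrite addr_ge0 ?ltW.
set c := Num.sqrt _ in h *.
have -> : alpha = c ^+ 2 - 1 by rewrite h; ring.
by field.
Qed.

(* Main.v *)
Require Import Defs.
From HB Require Import structures.
From mathcomp Require Import all_boot all_order all_algebra.
From mathcomp Require Import ring lra.
From mathcomp Require Import all_classical all_reals all_analysis.
From mathcomp Require Import measurable_realfun.

Set Implicit Arguments.
Unset Strict Implicit.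
Unset Printing Implicit Defensive.

Import Order.TTheory GRing.Theory Num.Theory.
Local Open Scope ring_scope.

Import numFieldNormedType.Exports.
Local Open Scope classical_set_scope.

(** Write [c] for [sqrt (alpha + 1)]. The weight is
    [4 x^alpha e^(-x) / ((x - r) (x - s))^2], and [r < s < 0] because [c > 1],
    so it has no singularity on the half-line, and multiplying it by powers of
    [x - r] and [x - s] leaves something that decays like [e^(-x/2)]: every
    moment converges.

    Formula (a) holds for the integrands themselves, since
    [x - r = (x - s) + 2 c].

    Formula (b) integrates an exact derivative. Let [w_(i,j)] be the integrand
    of the [(i, j)] moment. The function [F = x w_(i,j+1)] has logarithmic
    derivative
      [(alpha + 1) / x - 1 + (i - 2) / (x - r) + (j - 1) / (x - s)],
    and [F = x (x - r) (x - s) w_(i-1,j)], where [i >= 1] makes [w_(i-1,j)] the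
    integrand of a moment. Multiplying out, the denominators cancel and [F'] is
    [w_(i-1,j)] times a polynomial of degree three. Expanding it in terms of [(x - r)^2 (x - s)], [(x - r)^2], [x - r] and [1] gives
    [F' = - w_(i+1,j+1) + A w_(i+1,j) + B w_(i,j) + C w_(i-1,j)], where
    [A], [B], [C] are the coefficients of the recursion
    ([is_derive_primitive]). As [F] vanishes at [0] and at infinity, the
    integral of [F'] is zero, by the fundamental theorem of calculus for
    functions of varying sign ([dominated_continuous_FTC2y]). *)

(** * The fundamental theorem of calculus on a half-line under domination *)

Section dominated_FTC.
Variables (R : realType) (a : R) (f g G : R -> R) (m : R).
Notation mu := (@lebesgue_measure R).
Hypotheses (fg : forall x, a <= x -> `|f x| <= g x)
  (cf : {within `[a, +oo[, continuous f})
  (cg : {within `[a, +oo[, continuous g})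
  (Gm : G x @[x --> +oo] --> m)
  (dG : forall x : R, a < x -> is_derive x 1 G (g x))
  (Ga : G x @[x --> a^'+] --> G a).

Let g_ge0 x : a <= x -> 0 <= g x.
Proof. by move=> /fg; exact: le_trans. Qed.

Let derive1G : {in `]a, +oo[%R, G^`() =1 g}.
Proof.
move=> x; rewrite in_itv/= andbT => /dG dGx.
by rewrite derive1E derive_val.
Qed.

Let derivableG x : a < x -> derivable G x 1.
Proof. by move=> /dG dGx; exact: ex_derive. Qed.

Let measurable_within_itvcy (h : R -> R) :
  {within `[a, +oo[, continuous h} -> measurable_fun `[a, +oo[ h.
Proof. by move=> ch; exact: subspace_continuous_measurable_fun. Qed.

Let integrable_dominating : mu.-integrable `[a, +oo[ (EFin \o g).
Proof.
apply/integrableP; split.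
  by apply/measurable_EFinP; exact: measurable_within_itvcy.
under eq_integral.
  move=> x /[!inE]/=; rewrite in_itv/= andbT => ax.
  rewrite ger0_norm ?g_ge0//.
  over.
by rewrite (ge0_continuous_FTC2y g_ge0 cg Gm derivableG Ga derive1G) -EFinB ltry.
Qed.

Lemma integrable_dominated : mu.-integrable `[a, +oo[ (EFin \o f).
Proof.
apply: (le_integrable _ _ _ integrable_dominating) => //=.
  by apply/measurable_EFinP; exact: measurable_within_itvcy.
move=> x; rewrite in_itv/= andbT => ax.
by rewrite lee_fin (ger0_norm (g_ge0 ax)) fg.
Qed.

(** The half-line version of the fundamental theorem for nonnegative integrands
    applies to [f + g] and to [g], both nonnegative because [g] dominates
    [|f|]; the difference of the two instances is the claim for [f]. *)
Lemma dominated_continuous_FTC2y (F : R -> R) (l : R) :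
  F x @[x --> +oo] --> l ->
  (forall x : R, a < x -> is_derive x 1 F (f x)) ->
  F x @[x --> a^'+] --> F a ->
  \int[mu]_(x in `[a, +oo[) f x = l - F a.
Proof.
move=> Fl dF Fa.
have -> : \int[mu]_(x in `[a, +oo[) f x =
    \int[mu]_(x in `[a, +oo[) (f x + g x) - \int[mu]_(x in `[a, +oo[) g x.
  by rewrite RintegralD ?addrK//; exact: integrable_dominated.
rewrite (Rintegral_ge0_continuous_FTC2y g_ge0 cg Gm derivableG Ga derive1G).
rewrite (@Rintegral_ge0_continuous_FTC2y _ (f \+ g) (F \+ G) a (l + m)).
- by rewrite /=; ring.
- by move=> x /fg; rewrite ler_norml => /andP[+ _]; rewrite -subr_ge0 opprK.
- by move=> x; apply: continuousD; [exact: cf|exact: cg].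
- exact: cvgD.
- move=> x ax; have ? := dF _ ax; have ? := dG ax.
  by apply: derivableD; exact: ex_derive.
- exact: cvgD.
- move=> x; rewrite in_itv/= andbT => ax.
  have ? := dF _ ax; have ? := dG ax.
  by rewrite derive1E derive_val.
Qed.

End dominated_FTC.

(** * Growth and decay classes *)

(** Requiring a bound for every rate [e] is what makes the class closed under
    products. Constraining only [0 <= x] avoids the poles at negative roots. *)
Definition subexponential (R : realType) (f : R -> R) :=
  forall e : R, 0 < e ->
    exists M, forall x, 0 <= x -> `|f x| <= M * expR (e * x).

Section subexponential.
Variable R : realType.
Implicit Types (f g : R -> R) (c : R).

Let expR_ge1 (x : R) : 0 <= x -> 1 <= expR x.
Proof. by move=> x0; rewrite -[leLHS]expR0 ler_expR. Qed.

Lemma subexponential_bounded f c :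
  (forall x, 0 <= x -> `|f x| <= c) -> subexponential f.
Proof.
move=> fc e e0; exists c => x x0; rewrite (le_trans (fc _ x0))//.
have c0 : 0 <= c by rewrite (le_trans _ (fc _ x0)).
by rewrite ler_peMr// expR_ge1// mulr_ge0// ltW.
Qed.

Lemma subexponentialM f g :
  subexponential f -> subexponential g -> subexponential (fun x => f x * g x).
Proof.
move=> sf sg e e0; have e20 : 0 < e / 2 by rewrite divr_gt0.
have [M fM] := sf _ e20; have [N gN] := sg _ e20.
exists (M * N) => x x0; rewrite normrM [e]splitr mulrDl expRD mulrACA.
by apply: ler_pM => //; [exact: fM|exact: gN].
Qed.

Lemma subexponentialX f n :
  subexponential f -> subexponential (fun x => f x ^+ n).
Proof.
move=> sf; elim: n => [|n IHn].
  by apply: (@subexponential_bounded _ 1) => x _; rewrite expr0 normr1.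
under eq_fun do rewrite exprS.
exact: subexponentialM.
Qed.

Lemma subexponential_shift c : subexponential (fun x => x - c).
Proof.
(* [x <= e^-1 * expR (e * x)] is the inequality [1 + y <= expR y] at [e * x]. *)
move=> e e0; exists (`|c| + e^-1) => x x0.
rewrite (le_trans (ler_normB _ _))// mulrDl addrC lerD//.
  by rewrite ler_peMr// expR_ge1// mulr_ge0// ltW.
rewrite ger0_norm// mulrC ler_pdivlMr// mulrC.
by rewrite (le_trans _ (expR_ge1Dx _))// lerDr.
Qed.

(** Raising [x <= M * expR (e / c * x)] to the power [c] gives rate [e]. *)
Lemma subexponential_powR c : 0 < c -> subexponential (fun x => x `^ c).
Proof.
move=> c0 e e0; have ec0 : 0 < e / c by rewrite divr_gt0.
have [M idM] := @subexponential_shift 0 _ ec0.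
exists (M `^ c) => x x0; rewrite ger0_norm ?powR_ge0//.
have xM := idM _ x0; rewrite subr0 ger0_norm// in xM.
have M0 : 0 <= M.
  by have := idM _ (lexx 0); rewrite mulr0 expR0 mulr1; exact: le_trans.
apply: (le_trans (ge0_ler_powR (ltW c0) _ _ xM)).
- by rewrite nnegrE.
- by rewrite nnegrE mulr_ge0// expR_ge0.
rewrite powRM ?expR_ge0// -expRM mulrAC.
by rewrite divfK ?gt_eqF.
Qed.

End subexponential.

Lemma is_derive_expRM (R : realType) (k x : R) :
  is_derive x 1 (fun y => expR (k * y)) (expR (k * x) * k).
Proof.
have dkZ : is_derive x 1 (fun y => k * y) _ := is_deriveZ k (is_derive_id x 1).
have dk : is_derive x 1 (fun y => k * y) k.
  by apply: is_derive_eq dkZ _; rewrite /GRing.scale/= mulr1.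
exact: is_derive1_comp (is_derive_expR (k * x)) dk.
Qed.

(** The rate [1/2] is one choice between [0] and [1]: it leaves half of
    [expR (- x)] to absorb a subexponential factor. Continuity on the closed half-line
    is included so that the class carries all that integration requires. *)
Definition exp_decay (R : realType) (f : R -> R) :=
  {within `[0, +oo[, continuous f} /\
  exists M, forall x, 0 <= x -> `|f x| <= M * expR (- (x / 2)).

Section exp_decay.
Variable R : realType.
Implicit Types (f g : R -> R) (c : R).
Notation mu := (@lebesgue_measure R).

Lemma subexponential_exp_decay f : subexponential f ->
  {within `[0, +oo[, continuous (fun x => f x * expR (- x))} ->
  exp_decay (fun x => f x * expR (- x)).
Proof.
move=> /(_ (2^-1)) [|M fM cf]; first by rewrite invr_gt0.
split=> //; exists M => x x0; rewrite normrM (ger0_norm (expR_ge0 _)).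
rewrite -ler_pdivlMr ?expR_gt0// -mulrA -expRN -expRD opprK.
rewrite (le_trans (fM _ x0))// (_ : - (x / 2) + x = 2^-1 * x)//.
by field.
Qed.

Lemma exp_decayD f g : exp_decay f -> exp_decay g -> exp_decay (f \+ g).
Proof.
move=> [cf [M fM]] [cg [N gN]]; split.
  by move=> x; apply: continuousD; [exact: cf|exact: cg].
exists (M + N) => x x0; rewrite mulrDl (le_trans (ler_normD _ _))//.
by rewrite lerD ?fM ?gN.
Qed.

Lemma exp_decayZ c f : exp_decay f -> exp_decay (fun x => c * f x).
Proof.
move=> [cf [M fM]]; split.
  by move=> x; apply: continuousM; [exact: cst_continuous|exact: cf].
by exists (`|c| * M) => x x0; rewrite normrM -mulrA ler_wpM2l ?fM.
Qed.

Lemma is_derive_expR_half c (x : R) :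
  is_derive x 1 (fun y => c * expR (- (y / 2))) (- (c / 2) * expR (- (x / 2))).
Proof.
have -> : (fun y => c * expR (- (y / 2))) = (fun y => c * expR (- 2^-1 * y)).
  by apply/funext => y; congr (_ * expR _); ring.
have dc : is_derive x 1 (fun y => c * expR (- 2^-1 * y)) _ :=
  is_deriveZ c (is_derive_expRM (- 2^-1) x).
apply: is_derive_eq dc _; rewrite /GRing.scale/=.
by rewrite (_ : - 2^-1 * x = - (x / 2)); ring.
Qed.

Lemma cvg_expR_half c : c * expR (- (x / 2)) @[x --> +oo] --> (0 : R).
Proof.
rewrite -[X in _ --> X](mulr0 c); apply: cvgMr.
apply: (@cvg_comp _ _ _ (fun x => x / 2) (fun x => expR (- x)) _ _ _ _
  (@cvgr_expR R)).
by apply: gt0_cvgMly => //; rewrite invr_gt0.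
Qed.

Lemma exp_decay_cvg0 f : exp_decay f -> f x @[x --> +oo] --> 0.
Proof.
move=> [_ [M fM]]; apply/norm_cvg0P.
apply: (@squeeze_cvgr _ _ _ _ (cst 0) (fun x => M * expR (- (x / 2)))).
- by near=> x; rewrite normr_ge0/= fM.
- exact: cvg_cst.
- exact: cvg_expR_half.
Unshelve. all: by end_near. Qed.

Let continuous_expR_half c : continuous (fun x : R => c * expR (- (x / 2))).
Proof.
move=> x; apply/differentiable_continuous/derivable1_diffP.
by have dx := is_derive_expR_half c x; exact: ex_derive.
Qed.

Let is_derive_bound c (x : R) :
  is_derive x 1 (fun y => - (2 * c) * expR (- (y / 2))) (c * expR (- (x / 2))).
Proof. by apply: is_derive_eq (is_derive_expR_half _ _) _; field. Qed.

Lemma exp_decay_integrable f :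
  exp_decay f -> mu.-integrable `[0, +oo[ (EFin \o f).
Proof.
move=> [cf [M fM]]; apply: (integrable_dominated fM cf).
- exact/continuous_subspaceT/continuous_expR_half.
- exact: (cvg_expR_half (- (2 * M))).
- by move=> x _; exact: is_derive_bound.
- exact/cvg_at_right_filter/continuous_expR_half.
Qed.

(** The boundary term at infinity vanishes by decay. *)
Lemma exp_decay_Rintegral_derive f g : exp_decay f -> exp_decay g ->
  (forall x : R, 0 < x -> is_derive x 1 f (g x)) ->
  \int[mu]_(x in `[0, +oo[) g x = - f 0.
Proof.
move=> df [cg [M gM]] dfg; rewrite -[RHS]add0r.
apply: (@dominated_continuous_FTC2y _ _ _ (fun x => M * expR (- (x / 2)))
  (fun x => - (2 * M) * expR (- (x / 2))) 0 gM cg) => //.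
- exact/continuous_subspaceT/continuous_expR_half.
- exact: cvg_expR_half.
- exact/cvg_at_right_filter/continuous_expR_half.
- exact: exp_decay_cvg0.
- by case: df => /continuous_within_itvcyP[].
Qed.

Lemma exp_decay_RintegralZ c f : exp_decay f ->
  \int[mu]_(x in `[0, +oo[) (c * f x) = c * \int[mu]_(x in `[0, +oo[) f x.
Proof. by move=> df; rewrite RintegralZl//; exact: exp_decay_integrable. Qed.

Lemma exp_decay_RintegralD f g : exp_decay f -> exp_decay g ->
  \int[mu]_(x in `[0, +oo[) (f x + g x) =
  \int[mu]_(x in `[0, +oo[) f x + \int[mu]_(x in `[0, +oo[) g x.
Proof. by move=> df dg; rewrite RintegralD//; exact: exp_decay_integrable. Qed.

End exp_decay.

(** * Logarithmic derivatives *)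

(** Stating [f' x] as [f x * l], with [l] the logarithmic derivative, makes
    products and powers act additively on [l], with no special case for the
    exponent [0]. *)
Section logarithmic_derivative.
Variables (R : realType) (x : R).
Implicit Types (f g : R -> R) (l m : R).

Lemma log_deriveM f g l m :
  is_derive x 1 f (f x * l) -> is_derive x 1 g (g x * m) ->
  is_derive x 1 (fun y => f y * g y) (f x * g x * (l + m)).
Proof.
move=> df dg.
have dfg : is_derive x 1 (fun y => f y * g y) _ := is_deriveM df dg.
by apply: is_derive_eq dfg _; rewrite /GRing.scale/=; ring.
Qed.

Lemma log_deriveX f l n :
  is_derive x 1 f (f x * l) ->
  is_derive x 1 (fun y => f y ^+ n) (f x ^+ n * (n%:R * l)).
Proof.
move=> df; elim: n => [|n IHn].
  have d1 : is_derive x 1 (fun y => f y ^+ 0) 0 := is_derive_cst (1 : R) x 1.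
  by apply: is_derive_eq d1 _; rewrite mul0r mulr0.
under eq_fun do rewrite exprS.
by apply: is_derive_eq (log_deriveM df IHn) _; rewrite -exprS -natr1; ring.
Qed.

Lemma log_deriveV f l : f x != 0 ->
  is_derive x 1 f (f x * l) ->
  is_derive x 1 (fun y => (f y)^-1) ((f x)^-1 * - l).
Proof.
move=> fx0 df; have dfx : derivable f x 1 by exact: ex_derive.
split; first exact: derivableV.
by rewrite deriveV// derive_val /GRing.scale/=; field.
Qed.

Lemma log_derive_shift c : x != c ->
  is_derive x 1 (fun y => y - c) ((x - c) * (x - c)^-1).
Proof.
move=> xc; rewrite divff ?subr_eq0//.
have dc : is_derive x 1 (fun y => y - c) _ :=
  is_deriveB (is_derive_id x 1) (is_derive_cst c x 1).
by apply: is_derive_eq dc _; rewrite subr0.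
Qed.

Lemma log_derive_expRN :
  is_derive x 1 (fun y => expR (- y)) (expR (- x) * - 1).
Proof.
by rewrite -[- x]mulN1r; under eq_fun do rewrite -mulN1r; exact: is_derive_expRM.
Qed.

Lemma log_derive_powR a : 0 < x ->
  is_derive x 1 (fun y => y `^ a) (x `^ a * (a / x)).
Proof.
move=> x0; apply: is_derive_eq (is_derive1_powR a x0) _.
rewrite powRB; last by rewrite (gt_eqF x0) implybT.
by rewrite powRr1 ?(ltW x0)//; ring.
Qed.

End logarithmic_derivative.

(** * The moments of the exceptional weight *)

Section moments.
Variables (R : realType) (alpha : R).
Hypothesis alpha_gt0 : 0 < alpha.
Notation mu := (@lebesgue_measure R).
Notation c := (Num.sqrt (alpha + 1)).
Notation r := (root_r alpha).
Notation s := (root_s alpha).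
Notation m := (moment_integrand alpha).

Lemma sqr_c : c ^+ 2 = alpha + 1.
Proof. by rewrite sqr_sqrtr// addr_ge0// ltW. Qed.

(** [alpha > 0] gives [c > 1], hence [s = c - c ^+ 2 < 0]. *)
Lemma root_s_lt0 : s < 0.
Proof.
have c1 : 1 < c by rewrite -{1}[1]sqrtr1 ltr_sqrt ?ltrDr ?addr_gt0//.
rewrite /root_s -{1}sqr_c expr2 addrC subr_lt0 ltr_pMr//.
exact: lt_trans c1.
Qed.

Lemma root_r_lt0 : r < 0.
Proof.
by have := root_s_lt0; have := sqrtr_ge0 (alpha + 1); rewrite /root_s /root_r; lra.
Qed.

Definition rational_factor (i j : nat) (x : R) : R :=
  4 * ((x - r) ^+ i * (x - s) ^+ j * ((x - r) * (x - s))^-1 ^+ 2).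

Lemma moment_integrandE i j x :
  m i j x = rational_factor i j x * x `^ alpha * expR (- x).
Proof.
rewrite /moment_integrand /X2_weight /rational_factor laguerre2_roots//.
rewrite expr_div_n invf_div -exprVn.
have -> : (2 : R) ^+ 2 = 4 by ring.
ring.
Qed.

Lemma subr_root_gt0 x : 0 <= x -> 0 < x - r /\ 0 < x - s.
Proof. by have := root_s_lt0; have := root_r_lt0; split; lra. Qed.

(** Since [r] and [s] are negative, the inverse factors are bounded on the
    half-line by their values at [0]. *)
Lemma subexponential_rational_factor i j : subexponential (rational_factor i j).
Proof.
have bounded_inv a : a < 0 -> subexponential (fun x : R => (x - a)^-1).
  move=> a0; apply: (@subexponential_bounded _ _ (- a)^-1) => x x0.
  by rewrite gtr0_norm ?invr_gt0 ?lef_pV2 ?posrE; lra.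
apply: subexponentialM.
  by apply: (@subexponential_bounded _ _ 4) => x _; rewrite ger0_norm.
apply: subexponentialM.
  by apply: subexponentialM; apply: subexponentialX; exact: subexponential_shift.
apply: subexponentialX; under eq_fun do rewrite invfM.
apply: subexponentialM; apply: bounded_inv; [exact: root_r_lt0|exact: root_s_lt0].
Qed.

Definition log_derive_rational (i j : nat) (x : R) : R :=
  (i%:R - 2) / (x - r) + (j%:R - 2) / (x - s).

Lemma is_derive_rational_factor i j (x : R) : 0 <= x ->
  is_derive x 1 (rational_factor i j)
    (rational_factor i j x * log_derive_rational i j x).
Proof.
move=> /subr_root_gt0[xr xs].
have xNr : x != r by rewrite -subr_eq0 gt_eqF.
have xNs : x != s by rewrite -subr_eq0 gt_eqF.
have dr := log_derive_shift xNr; have ds := log_derive_shift xNs.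
have nz : (x - r) * (x - s) != 0 by rewrite gt_eqF ?mulr_gt0.
have drs : is_derive x 1 (fun y => ((y - r) * (y - s))^-1 ^+ 2) _ :=
  log_deriveX 2
    (@log_deriveV _ _ (fun y => (y - r) * (y - s)) _ nz (log_deriveM dr ds)).
have dp := log_deriveM (log_deriveM (log_deriveX i dr) (log_deriveX j ds)) drs.
have d4 : is_derive x 1 (rational_factor i j) _ := is_deriveZ 4 dp.
apply: is_derive_eq d4 _.
rewrite /GRing.scale/= /rational_factor /log_derive_rational.
by field; rewrite !gt_eqF.
Qed.

Lemma is_derive_moment_integrand i j (x : R) : 0 < x ->
  is_derive x 1 (m i j)
    (m i j x * (log_derive_rational i j x + alpha / x - 1)).
Proof.
move=> x0; have dq := is_derive_rational_factor i j (ltW x0).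
have dqp := log_deriveM dq (log_derive_powR alpha x0).
have dm := log_deriveM dqp (log_derive_expRN x).
rewrite (_ : m i j = fun y => rational_factor i j y * y `^ alpha * expR (- y))//.
by apply/funext => y; exact: moment_integrandE.
Qed.

(** The endpoint [0] is treated separately, by a one-sided limit: [x `^ alpha]
    tends to [0] from the right, but is constantly [1] for negative [x]. *)
Lemma continuous_moment_integrand i j : {within `[0, +oo[, continuous (m i j)}.
Proof.
apply/continuous_within_itvcyP; split.
  move=> x; rewrite in_itv/= andbT => x0.
  have dm := is_derive_moment_integrand i j x0.
  by apply/differentiable_continuous/derivable1_diffP; exact: ex_derive.
pose q x := rational_factor i j x * expR (- x).
have -> : m i j = fun x => q x * x `^ alpha.
  by apply/funext => x; rewrite moment_integrandE mulrAC.
rewrite (powR0 (lt0r_neq0 alpha_gt0)).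
apply: cvgM; last exact: powR_cvg0.
apply: cvg_at_right_filter.
have dr := is_derive_rational_factor i j (lexx 0).
have dq := log_deriveM dr (log_derive_expRN 0).
by apply/differentiable_continuous/derivable1_diffP; exact: ex_derive.
Qed.

Lemma exp_decay_moment_integrand i j : exp_decay (m i j).
Proof.
have mE : m i j = fun x => rational_factor i j x * x `^ alpha * expR (- x).
  by apply/funext => x; exact: moment_integrandE.
rewrite mE; apply: subexponential_exp_decay.
  apply: subexponentialM; first exact: subexponential_rational_factor.
  exact: subexponential_powR.
by rewrite -mE; exact: continuous_moment_integrand.
Qed.

Lemma integrable_moment_integrand i j :
  mu.-integrable `]0, +oo[ (EFin \o m i j).
Proof.
have := exp_decay_integrable (exp_decay_moment_integrand i j).
apply: integrableS => //.
by apply: subset_itvr; rewrite bnd_simp.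
Qed.

Lemma adjusted_momentE i j :
  adjusted_moment alpha i j = \int[mu]_(x in `[0, +oo[) m i j x.
Proof. exact/Rintegral_itv_obnd_cbnd/integrable_moment_integrand. Qed.

Lemma moment_integrandSl i j x : m i.+1 j x = (x - r) * m i j x.
Proof. by rewrite /moment_integrand exprS; ring. Qed.

Lemma moment_integrandSr i j x : m i j.+1 x = (x - s) * m i j x.
Proof. by rewrite /moment_integrand exprS; ring. Qed.

(** This is the integrand of the four-term recursion: multiply the logarithmic
    derivative out, then substitute [alpha = c ^+ 2 - 1] so that the claim
    becomes a rational identity in [x] and [c]. The index [i] is shifted by one
    from that of the recursion, whose [i] is positive. *)
Lemma is_derive_primitive i j (x : R) : 0 < x ->
  is_derive x 1 (fun y => y * m i.+1 j.+1 y)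
   (((i.+1%:R + j%:R - 1 + 2 * alpha + c) * m i.+2 j x
     + ((1 - i.+1%:R - j%:R) * (alpha + 1)
        + (3 - 3 * i.+1%:R - j%:R - 4 * alpha) * c) * m i.+1 j x
     + ((2 * i.+1%:R - 4) * (alpha + 1) * (c + 1)) * m i j x)
     + -1 * m i.+2 j.+1 x).
Proof.
move=> x0; have [xr xs] := subr_root_gt0 (ltW x0).
have dx : is_derive x 1 (fun y => y) (x * x^-1).
  by rewrite divff ?gt_eqF//; exact: is_derive_id.
apply: is_derive_eq (log_deriveM dx (is_derive_moment_integrand _ _ x0)) _.
rewrite !(moment_integrandSl, moment_integrandSr) /log_derive_rational.
move: xr xs (sqr_c); rewrite /root_r /root_s; set d := c => xr xs hd.
have -> : alpha = d ^+ 2 - 1 by rewrite hd; ring.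
rewrite -!natr1; field.
by rewrite subrK hd !gt_eqF.
Qed.

(** Writing [x] as [(x - s) + s] turns the primitive into a combination of two
    moment integrands. *)
Lemma exp_decay_primitive i j : exp_decay (fun x => x * m i j.+1 x).
Proof.
have -> : (fun x => x * m i j.+1 x) = m i j.+2 \+ (fun x => s * m i j.+1 x).
  by apply/funext => x /=; rewrite [m i j.+2 x]moment_integrandSr; ring.
apply: exp_decayD; first exact: exp_decay_moment_integrand.
exact/exp_decayZ/exp_decay_moment_integrand.
Qed.

End moments.

Theorem theorem5p1 (R : realType) (alpha : R) (halpha : 0 < alpha) :
  [/\ (* the moments are convergent integrals *)
      forall i j : nat,
        (@lebesgue_measure R).-integrable `]0, +oo[%classic
          (EFin \o moment_integrand alpha i j),
      (* (a) *)
      forall i j : nat,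
        adjusted_moment alpha i.+1 j =
          adjusted_moment alpha i j.+1
          + 2 * Num.sqrt (alpha + 1) * adjusted_moment alpha i j
    & (* (b) *)
      forall i j : nat, (0 < i)%N ->
        adjusted_moment alpha i.+1 j.+1 =
          (i%:R + j%:R - 1 + 2 * alpha + Num.sqrt (alpha + 1))
            * adjusted_moment alpha i.+1 j
          + ((1 - i%:R - j%:R) * (alpha + 1)
             + (3 - 3 * i%:R - j%:R - 4 * alpha) * Num.sqrt (alpha + 1))
            * adjusted_moment alpha i j
          + ((2 * i%:R - 4) * (alpha + 1) * (Num.sqrt (alpha + 1) + 1))
            * adjusted_moment alpha i.-1 j].
Proof.
split.
- exact: integrable_moment_integrand.
- move=> i j; rewrite !adjusted_momentE//.
  rewrite -exp_decay_RintegralZ -?exp_decay_RintegralD;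
    do ?[apply: exp_decayD|apply: exp_decayZ|exact: exp_decay_moment_integrand].
  apply: eq_Rintegral => x _ /=.
  by rewrite !(moment_integrandSl, moment_integrandSr) /root_r /root_s; ring.
- move=> [//|i] j _; rewrite [i.+1.-1]/= !adjusted_momentE//.
  set a1 := (X in _ = X * _ + _ * _ + _); set a2 := (X in _ = _ + X * _ + _).
  set a3 := (X in _ = _ + X * _).
  pose m := moment_integrand alpha.
  have decm i' j' : exp_decay (m i' j') by exact: exp_decay_moment_integrand.
  have dec1 := exp_decayZ a1 (decm i.+2 j).
  have dec2 := exp_decayZ a2 (decm i.+1 j).
  have dec3 := exp_decayZ a3 (decm i j).
  have dec12 := exp_decayD dec1 dec2.
  have dec123 := exp_decayD dec12 dec3.
  have dec4 := exp_decayZ (-1) (decm i.+2 j.+1).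
  have := exp_decay_Rintegral_derive (exp_decay_primitive halpha i.+1 j)
    (exp_decayD dec123 dec4) (@is_derive_primitive _ _ halpha i j).
  rewrite mul0r oppr0 /= (exp_decay_RintegralD dec123)//.
  rewrite (exp_decay_RintegralD dec12)// (exp_decay_RintegralD dec1)//.
  rewrite !exp_decay_RintegralZ// mulN1r => /subr0_eq/esym.
  exact.
Qed.
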